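(* Let $n\ge 1$ and let $\mathbf{c}=(c_1,\dots,c_k)$ be a cell vector of nonnegative integers. Then $$\mathcal{S}(\mathbf{1}^n;\mathbf{c})=\Big(\sum_{i=1}^k c_i\Big)\,\mathcal{S}(\mathbf{1}^{n-1};\mathbf{c})+\sum_{i=1}^k \mathcal{S}(\mathbf{1}^{n-1};\mathbf{c}-\mathbf{e}_i),$$ where $\mathbf{e}_i$ is the $i$-th standard basis vector of $\mathbb{Z}^k$.
   Context: For a nonnegative integer $n$ and a vector $\mathbf{c}=(c_1,\dots,c_k)$ of nonnegative integers, $\mathcal{S}(\mathbf{1}^n;\mathbf{c})$ (the mixed, or multi-set, Stirling number) is the number of ways to distribute $n$ distinct balls into $c_1+\dots+c_k$ cells, $c_i$ of them being of type $i$, so that no cell is empty; cells of the same type are indistinguishable, cells of different types are distinguishable. Equivalently, it is the number of $k$-tuples $(P_1,\dots,P_k)$ where $P_i$ is a set of $c_i$ nonempty subsets of $\{1,\dots,n\}$ and all the $c_1+\dots+c_k$ subsets together are pairwise disjoint with union $\{1,\dots,n\}$. By convention, $\mathcal{S}(\mathbf{1}^n;\mathbf{c})=0$ if some component of $\mathbf{c}$ is negative. *)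

(* Defs.v *)
From mathcomp Require Import all_boot all_order all_algebra.

Set Implicit Arguments.
Unset Strict Implicit.
Unset Printing Implicit Defensive.

Import Order.TTheory GRing.Theory Num.Theory.

Local Open Scope ring_scope.

(* Balls are the elements of 'I_n, and P i is the set of (contents of the)
   cells of type i.  Comparing the tagged cells (i, A) and (j, B) makes the
   disjointness condition range over distinct cells, whether or not they have
   the same type. *)
Definition is_distribution (n k : nat) (c : 'rV[int]_k)
    (P : {ffun 'I_k -> {set {set 'I_n}}}) : bool :=
  [&& [forall i, #|P i|%:Z == c 0 i],
      [forall i, forall A in P i, A != set0],
      [forall i, forall A in P i, forall j, forall B in P j,
         ((i, A) != (j, B)) ==> [disjoint A & B]]
    & \bigcup_i cover (P i) == [set: 'I_n]].

(* Cell vectors live in Z^k so that c - e_i always makes sense; the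
   test is the convention for vectors with a negative component. *)
Definition mixed_stirling (n k : nat) (c : 'rV[int]_k) : nat :=
  if [forall i, 0 <= c 0 i]
  then #|[set P : {ffun 'I_k -> {set {set 'I_n}}} | is_distribution c P]|
  else 0%N.

(* Main.v *)
Require Import Defs.
From mathcomp Require Import all_boot all_order all_algebra.

Set Implicit Arguments.
Unset Strict Implicit.
Unset Printing Implicit Defensive.

Import Order.TTheory GRing.Theory Num.Theory.

Local Open Scope ring_scope.

(** The classical argument looks at the cell that contains one chosen ball [x]:
    either [x] is alone in it, or removing [x] leaves a smaller nonempty cell.
    Here a distribution of a set [E] of balls is encoded as a set [Q] of pairs
    (type, contents), and both cases come from one count
    ([card_dist_containing]): if [A] is a nonempty subset of [E], deleting the
    cell [(i, A)] is a bijection from the distributions of [E] with cell vector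
    [c] that contain [(i, A)] to the distributions of [E :\: A] with cell vector
    [c - e_i].  Now let [x \notin E].  A distribution of [x |: E] has exactly
    one cell [(i, x |: B)] with [x \notin B], and
    [(x |: E) :\: (x |: B) = E :\: B].  Hence the distributions of [x |: E] with
    the cell [(i, x |: B)] are counted by those of [E :\: B] with cell vector
    [c - e_i].  For [B] empty this is the term of [c - e_i]; for [B] nonempty,
    the same count applied to [E] says that it is the number of distributions
    of [E] with cell vector [c] that contain [(i, B)].  Summing the latter over
    all [(i, B)] counts each distribution of [E] once per cell, that is
    [\sum_i c_i] times.

    The number of distributions of [E] depends only on [#|E|], so the recurrence
    is used with ['I_n.+1] as the set of balls, [x] the last one and [E] a copy
    of ['I_n]. *)

(** * Distributions as sets of tagged cells *)

Section TaggedCells.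

Variables (I T : finType).
Implicit Types (c : I -> int) (E A B : {set T}) (Q : {set I * {set T}}).

(** [Q] distributes the balls of [E] into nonempty cells, [c i] of them of
    type [i].  Disjointness and covering are expressed together: each ball of
    [E] lies in exactly one cell, and other balls lie in none.  There is no
    such [Q] if [c] has a negative value. *)
Definition tagged_dist c E Q : bool :=
  [&& [forall q in Q, q.2 != set0],
      [forall i, (\sum_(q in Q) (q.1 == i))%N%:Z == c i]
    & [forall y, (\sum_(q in Q) (y \in q.2))%N == (y \in E)]].

(** The set of all these distributions. *)
Definition dists c E : {set {set I * {set T}}} := [set Q | tagged_dist c E Q].

(** The cell vector [c - e_i]. *)
Definition dec c (i : I) : I -> int := fun j => c j - (j == i)%:R.

Lemma tagged_distP c E Q :
  reflect [/\ forall q, q \in Q -> q.2 != set0,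
              forall i, (\sum_(q in Q) (q.1 == i))%N%:Z = c i
            & forall y, (\sum_(q in Q) (y \in q.2))%N = (y \in E)]
          (Q \in dists c E).
Proof.
rewrite inE; apply: (iffP and3P) => [[/forall_inP h1 /forallP h2 /forallP h3]|].
  by split=> // [i|y]; apply/eqP.
case=> h1 h2 h3; split; first exact/forall_inP.
  by apply/forallP => i; apply/eqP.
by apply/forallP => y; apply/eqP.
Qed.

Lemma eq_dists c c' E : c =1 c' -> dists c E = dists c' E.
Proof.
move=> eq_c; apply/setP=> Q; rewrite !inE /tagged_dist.
by congr [&& _, _ & _]; apply: eq_forallb => i; rewrite eq_c.
Qed.

Lemma dist_cell_sub c E Q q : Q \in dists c E -> q \in Q -> q.2 \subset E.
Proof.
case/tagged_distP=> _ _ hE qQ; apply/subsetP=> y yq; have := hE y.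
by rewrite (bigD1 q) //= yq; case: (y \in E).
Qed.

Lemma card_dist c E Q : Q \in dists c E -> #|Q|%:Z = \sum_i c i.
Proof.
case/tagged_distP=> _ hc _.
rewrite -(eq_bigr _ (fun i _ => hc i)) -(big_morph Posz PoszD (erefl _)).
congr Posz; rewrite exchange_big -sum1_card; apply: eq_bigr => q _.
by rewrite (bigD1 q.1) //= eqxx big1 // => i; rewrite eq_sym => /negPf->.
Qed.

(** * Deleting a cell, and the recurrence *)

(** Deleting the cell [(i, A)] is a bijection; its inverse adds this cell, which
    is new because [A] is nonempty and disjoint from [E :\: A]. *)
Lemma card_dist_containing c E i A : A != set0 -> A \subset E ->
  #|[set Q in dists c E | (i, A) \in Q]| = #|dists (dec c i) (E :\: A)|.
Proof.
move=> A0 sAE.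
have notin Q : Q \in dists (dec c i) (E :\: A) -> (i, A) \notin Q.
  move=> dQ; apply/negP=> /(dist_cell_sub dQ)/= sA.
  case/set0Pn: A0 => y yA; have := subsetP sA y yA.
  by rewrite inE yA.
rewrite -(@card_in_imset _ _ (setU [set (i, A)]) (dists (dec c i) (E :\: A))).
  congr #|pred_of_set _|; apply/setP=> Q; rewrite inE.
  apply/andP/imsetP=> [[/tagged_distP[h0 hc hE] qQ]|[Q' dQ' ->]].
    exists (Q :\ (i, A)); last by rewrite setD1K.
    apply/tagged_distP; split=> [q /setD1P[_]|j|y]; first exact: h0.
      have := hc j; rewrite (big_setD1 _ qQ) /= /dec => <-.
      by rewrite PoszD eq_sym addrAC natz subrr add0r.
    have := hE y; rewrite (big_setD1 _ qQ) /= inE.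
    have := subsetP sAE y.
    case: (y \in A) => /= [->|_ <-] //; by case.
  have nQ' := notin _ dQ'; case/tagged_distP: dQ' => h0 hc hE.
  split; last by rewrite setU11.
  apply/tagged_distP; split=> [q /setU1P[->|]|j|y] //; first exact: h0.
    by rewrite big_setU1 //= PoszD hc /dec eq_sym natz addrC subrK.
  rewrite big_setU1 //= hE inE; have := subsetP sAE y.
  by case: (y \in A) => [->|].
by move=> Q1 Q2 d1 d2 e; rewrite -(setU1K (notin _ d1)) e setU1K ?notin.
Qed.

Lemma sum_card_containing c E :
  (\sum_(q : I * {set T}) #|[set Q in dists c E | q \in Q]|)%N =
  (\sum_(Q in dists c E) #|Q|)%N.
Proof.
transitivity (\sum_(q : I * {set T}) \sum_(Q in dists c E) (q \in Q))%N.
  apply: eq_bigr => q _; rewrite -sum1_card (eq_bigl _ _ (in_set _)).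
  by rewrite big_mkcondr.
rewrite exchange_big; apply: eq_bigr => Q _.
by rewrite -sum1_card [RHS]big_mkcond.
Qed.

(** The ball [x] lies in exactly one cell of each distribution. *)
Lemma card_dist_split c E x : x \in E ->
  #|dists c E| =
  (\sum_(q : I * {set T} | x \in q.2) #|[set Q in dists c E | q \in Q]|)%N.
Proof.
move=> xE; rewrite -sum1_card.
transitivity (\sum_(Q in dists c E) \sum_(q in Q) (x \in q.2))%N.
  by apply: eq_bigr => Q /tagged_distP[_ _ ->]; rewrite xE.
transitivity (\sum_(q : I * {set T} | x \in q.2)
                \sum_(Q in dists c E) (q \in Q))%N.
  rewrite exchange_big; apply: eq_bigr => Q _.
  rewrite [RHS]big_mkcond [LHS]big_mkcond; apply: eq_bigr => q _.
  by do 2!case: (_ \in _).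
apply: eq_bigr => q _; rewrite -sum1_card (eq_bigl _ _ (in_set _)).
by rewrite [RHS]big_mkcondr.
Qed.

Lemma containing_eq0 c E i A : ~~ ((A != set0) && (A \subset E)) ->
  #|[set Q in dists c E | (i, A) \in Q]| = 0%N.
Proof.
move=> nA; apply/eqP; rewrite cards_eq0; apply/eqP/setP=> Q.
rewrite in_set in_set0; apply/negbTE; apply: contra nA => /andP[dQ qQ].
by rewrite (dist_cell_sub dQ qQ) andbT; case/tagged_distP: dQ => /(_ _ qQ).
Qed.

(** The possible cells of type [i] around the new ball [x] are the [x |: B]:
    the first term on the right is [B = set0], the sum is over nonempty [B]
    (a [B] that is empty or not contained in [E] contributes nothing). *)
Lemma card_containing_setU1 c E x i : x \notin E ->
  (\sum_(A : {set T} | x \in A)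
     #|[set Q in dists c (x |: E) | (i, A) \in Q]|)%N =
  (#|dists (dec c i) E| +
     \sum_(A : {set T}) #|[set Q in dists c E | (i, A) \in Q]|)%N.
Proof.
move=> xE.
have setU1D B : x \notin B -> (x |: E) :\: (x |: B) = E :\: B.
  by move=> xB; rewrite -setDDl setU1K.
have U1neq0 B : x |: B != set0 by apply/set0Pn; exists x; rewrite setU11.
rewrite (reindex_onto (setU [set x]) (fun A => A :\ x)) => [|A xA]; last first.
  exact: setD1K.
rewrite (eq_bigl (fun B => x \notin B)) => [|B]; last first.
  rewrite setU11 /=; apply/eqP/idP => [<-|/setU1K//]; by rewrite !inE eqxx.
rewrite (bigD1 set0) ?inE //=; congr (_ + _)%N.
  by rewrite card_dist_containing ?setUS ?sub0set // setU1D ?inE // setD0.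
rewrite [RHS](bigID (fun B => (x \notin B) && (B != set0))) /=.
rewrite [X in _ = (_ + X)%N]big1 ?addn0.
  apply: eq_bigr => B /andP[xB B0].
  have [sBE|nsBE] := boolP (B \subset E).
    by rewrite !card_dist_containing ?setUS // setU1D.
  rewrite !containing_eq0 ?negb_and ?nsBE ?orbT //.
  apply/orP; right; apply: contra nsBE => /subsetP s; apply/subsetP=> y yB.
  have := s y; rewrite !inE yB orbT => /(_ isT) /predU1P[e|//].
  by rewrite -e yB in xB.
move=> B; rewrite negb_and negbK => h; apply: containing_eq0; rewrite negb_and.
case/orP: h => [xB|->//]; apply/orP; right; apply: contra xE => /subsetP; exact.
Qed.

(** The recurrence for the addition of one ball. *)
Lemma card_dists_setU1 c E x : x \notin E ->
  #|dists c (x |: E)|%:Z =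
  (\sum_i c i) * #|dists c E|%:Z + \sum_i #|dists (dec c i) E|%:Z.
Proof.
move=> xE.
have -> : #|dists c (x |: E)| =
          (\sum_i #|dists (dec c i) E| + \sum_(Q in dists c E) #|Q|)%N.
  rewrite (card_dist_split c (setU11 x E)) -sum_card_containing.
  transitivity (\sum_i \sum_(A : {set T} | x \in A)
                  #|[set Q in dists c (x |: E) | (i, A) \in Q]|)%N.
    by rewrite pair_big_dep; apply: eq_big => -[].
  rewrite (eq_bigr _ (fun i _ => card_containing_setU1 c i xE)) big_split /=.
  by rewrite pair_bigA; congr (_ + _)%N; apply: eq_bigr => -[].
rewrite PoszD !(big_morph Posz PoszD (erefl _)) addrC; congr (_ + _).
by rewrite (eq_bigr _ (@card_dist c E)) sumr_const -mulr_natr natz.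
Qed.

End TaggedCells.

(** * Relabelling the balls *)

(** Renaming the balls injectively, possibly inside a larger set, does not
    change the number of distributions. *)
Lemma card_dists_imset (I T T' : finType) (h : T -> T') (c : I -> int)
    (E : {set T}) : injective h -> #|dists c (h @: E)| = #|dists c E|.
Proof.
move=> inj_h; pose H (q : I * {set T}) := (q.1, h @: q.2).
have inj_H : injective H.
  by move=> [i A] [j B] [-> /(imset_inj inj_h)->].
have distH (Q : {set I * {set T}}) :
    (H @: Q \in dists c (h @: E)) = (Q \in dists c E).
  apply/tagged_distP/tagged_distP=> -[h0 hc hE]; split=> [q qQ|i|y].
  - by have := h0 _ (imset_f H qQ); rewrite imset_eq0.
  - by rewrite -hc big_imset //=; apply: in2W.
  - have := hE (h y); rewrite big_imset /=; last exact: in2W.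
    by rewrite mem_imset // => <-; apply: eq_bigr => q _; rewrite mem_imset.
  - by case/imsetP: qQ => r rQ ->; rewrite imset_eq0 h0.
  - by rewrite -hc big_imset //=; apply: in2W.
  rewrite big_imset /=; last exact: in2W.
  have [[z ->]|nz] := altP (@codomP _ _ h y).
    by rewrite mem_imset // -hE; apply: eq_bigr => q _; rewrite mem_imset.
  have out (A : {set T}) : y \in h @: A = false.
    by apply: contraNF nz => /imsetP[z _ ->]; exact: codom_f.
  by rewrite out big1 // => q _; rewrite out.
rewrite -(card_imset (dists c E) (imset_inj inj_H)).
congr #|pred_of_set _|; apply/setP=> Q; apply/idP/imsetP=> [dQ|[Q' dQ' ->]].
  (* The cells of [Q] lie in the image of [h], hence are images by [H]. *)
  have HQ : H @: (H @^-1: Q) = Q.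
    apply/setP=> q; apply/imsetP/idP=> [[r]|qQ]; first by rewrite inE => rQ ->.
    have hq : h @: (h @^-1: q.2) = q.2.
      apply/setP=> y; apply/imsetP/idP=> [[z]|yq]; first by rewrite inE => zq ->.
      have /imsetP[z _ ez] := subsetP (dist_cell_sub dQ qQ) y yq.
      by exists z; rewrite // inE -ez.
    by exists (q.1, h @^-1: q.2); rewrite ?inE /H /= hq -surjective_pairing.
  by exists (H @^-1: Q); rewrite // -distH HQ.
by rewrite distH.
Qed.

(** * Mixed Stirling numbers *)

(** The family [P] of sets of cells corresponds to the set of pairs [(i, A)]
    with [A \in P i].  The convention for negative components needs no separate
    case on the right, since [dists] is then empty. *)
Lemma mixed_stirlingE (n k : nat) (c : 'rV[int]_k) :
  mixed_stirling n c = #|dists (c 0) [set: 'I_n]|.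
Proof.
pose F (P : {ffun 'I_k -> {set {set 'I_n}}}) := [set q | q.2 \in P q.1].
pose G (Q : {set 'I_k * {set 'I_n}}) := [ffun i => [set A | (i, A) \in Q]].
have FK : cancel F G.
  by move=> P; apply/ffunP=> i; apply/setP=> A; rewrite ffunE !inE.
have GK : cancel G F.
  by move=> Q; apply/setP=> -[i A]; rewrite !inE ffunE inE.
have sumF P (f : 'I_k * {set 'I_n} -> nat) :
    (\sum_(q in F P) f q = \sum_i \sum_(A in P i) f (i, A))%N.
  rewrite pair_big_dep; apply: eq_big => -[i A] //=; by rewrite inE.
have count P i : (\sum_(q in F P) (q.1 == i))%N = #|P i|.
  rewrite sumF (bigD1 i) //= [X in (_ + X)%N]big1 ?addn0.
    by rewrite -sum1_card; apply: eq_bigr => A _; rewrite eqxx.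
  by move=> j /negPf ne; rewrite big1 // => A _; rewrite ne.
have distF P : is_distribution c P = (F P \in dists (c 0) [set: 'I_n]).
  apply/and4P/tagged_distP=> [[hc h0 hd hE]|[h0 hc hE]].
    split=> [[i A]|i|y].
    - by rewrite inE /= => AP; have /forallP/(_ i)/forall_inP/(_ A AP) := h0.
    - by rewrite count; have /forallP/(_ i)/eqP := hc.
    have : y \in \bigcup_i cover (P i) by rewrite (eqP hE) inE.
    case/bigcupP=> i _ /bigcupP[A AP yA]; rewrite inE.
    rewrite (bigD1 (i, A)) ?inE //= yA big1 // => -[j B] /andP[]; rewrite inE /=.
    move=> BP ne; have /forallP/(_ i)/forall_inP/(_ A AP)/forallP/(_ j) := hd.
    move/forall_inP/(_ B BP)/implyP; rewrite eq_sym => /(_ ne) /disjointFr.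
    by move=> /(_ y yA) ->.
  split.
  - by apply/forallP=> i; rewrite -count hc.
  - by apply/forallP=> i; apply/forall_inP=> A AP; apply: (h0 (i, A)); rewrite inE.
  - apply/forallP=> i; apply/forall_inP=> A AP; apply/forallP=> j.
    apply/forall_inP=> B BP; apply/implyP=> ne.
    rewrite disjoint_subset; apply/subsetP=> y yA; rewrite inE; apply/negP=> yB.
    have := hE y; rewrite (bigD1 (i, A)) ?inE //= yA.
    by rewrite (bigD1 (j, B)) /= ?yB // inE BP eq_sym.
  apply/eqP/setP=> y; rewrite [RHS]inE; have := hE y; rewrite in_setT.
  apply: contra_eqT => nE; rewrite big1 // => -[i A]; rewrite inE /= => AP.
  have [yA|//] := boolP (y \in A); case/bigcupP: nE; exists i => //.
  by apply/bigcupP; exists A.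
rewrite /mixed_stirling; case: forallP => [_|nc].
  rewrite -(@on_card_preimset _ _ F).
    by apply: eq_card => P; rewrite !inE distF inE.
  by exists G => x _; [apply: FK | apply: GK].
(* A negative value of [c] is not a number of cells. *)
apply/esym/eqP; rewrite cards_eq0; apply/eqP/setP=> Q; rewrite in_set0.
by apply/negP=> /tagged_distP[_ hc _]; case: nc => i; rewrite -hc.
Qed.

Theorem theorem2p1 (n k : nat) (c : 'rV[int]_k) (hn : (1 <= n)%N)
    (hc : forall i : 'I_k, 0 <= c 0 i) :
  (mixed_stirling n c)%:Z =
    (\sum_(i < k) c 0 i) * (mixed_stirling n.-1 c)%:Z
    + \sum_(i < k) (mixed_stirling n.-1 (c - delta_mx 0 i))%:Z.
Proof.
case: n hn => // n _ /=; rewrite !mixed_stirlingE.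
have cardE d : #|dists d [set: 'I_n]| = #|dists d (lift ord_max @: [set: 'I_n])|.
  by rewrite card_dists_imset //; apply: lift_inj.
have -> : [set: 'I_n.+1] = ord_max |: lift ord_max @: [set: 'I_n].
  apply/setP=> y; rewrite !inE; apply/esym.
  by case: (unliftP ord_max y) => [z ->|->]; rewrite ?eqxx // imset_f ?orbT ?inE.
rewrite card_dists_setU1 -?cardE; last first.
  by apply/imsetP=> -[z _ /eqP]; rewrite (negPf (neq_lift _ _)).
congr (_ + _); apply: eq_bigr => i _; rewrite mixed_stirlingE -cardE.
by congr (#|pred_of_set _|%:Z); apply: eq_dists => j; rewrite !mxE eqxx.
Qed.
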